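(* Suppose that $2/3<\delta\le1$, $0<\mu\le1$ and $b>1$. There exists $k_0\ge0$ such that for every $k\ge k_0$, if $t=\bigl\lfloor e^{\frac16k^\delta}\bigr\rfloor$ and $G$ is a graph with $n\le b^k$ vertices and with at least $e^{k^\delta}n$ edges, then $G$ contains the complete graph $K_t$ as a $t^\mu$-minor.
   Context: For a graph $G$ and a real $r\ge0$, an $r$-minor of $G$ is any graph obtained from $G$ by contracting pairwise vertex-disjoint connected subgraphs of radius at most $r$ and removing vertices and edges. *)

(* Defs.v *)
From HB Require Import structures.
From mathcomp Require Import all_boot all_order all_algebra.

Set Implicit Arguments.
Unset Strict Implicit.
Unset Printing Implicit Defensive.

Import Order.TTheory GRing.Theory Num.Theory.

Record sgraph := SGraph {
  vertex :> finType;
  adj : rel vertex;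
  adj_sym : symmetric adj;
  adj_irrefl : irreflexive adj }.

Definition edges (G : sgraph) : {set {set G}} :=
  [set e : {set G} | [exists x, exists y, adj x y && (e == [set x; y])]].

Lemma neq_sym (T : eqType) : symmetric (fun x y : T => x != y).
Proof. by move=> x y; rewrite eq_sym. Qed.

Lemma neq_irrefl (T : eqType) : irreflexive (fun x y : T => x != y).
Proof. by move=> x; rewrite eqxx. Qed.

Definition complete_graph (t : nat) : sgraph :=
  SGraph (@neq_sym 'I_t) (@neq_irrefl 'I_t).

Definition connected_graph (G : sgraph) : Prop :=
  (0 < #|G|)%N /\ forall x y : G, connect (@adj G) x y.

(* Length of a shortest walk from x to y; the junk value is #|G| when there is
   none (a shortest walk has length < #|G|). *)
Definition gdist (G : sgraph) (x y : G) : nat :=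
  find (fun n => [exists p : n.-tuple G, path (@adj G) x p && (last x p == y)])
       (iota 0 #|G|).

Definition eccentricity (G : sgraph) (x : G) : nat := \max_(y : G) gdist x y.

Definition radius (G : sgraph) : nat :=
  \big[minn/#|G|]_(x : G) eccentricity x.

(* Subgraphs need not be induced. *)
Record subgraph (G : sgraph) := Subgraph {
  sub_vertices : {set G};
  sub_adj : rel G;
  sub_adj_sym : symmetric sub_adj;
  sub_adj_incl : forall x y, sub_adj x y ->
    [/\ x \in sub_vertices, y \in sub_vertices & adj x y] }.

Section SubgraphAsGraph.
Variables (G : sgraph) (S : subgraph G).

Definition sub_vertex : finType := {x : G | x \in sub_vertices S}.

Definition sub_rel (u v : sub_vertex) : bool := sub_adj S (val u) (val v).

Lemma sub_rel_sym : symmetric sub_rel.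
Proof. by move=> u v; rewrite /sub_rel sub_adj_sym. Qed.

Lemma sub_rel_irrefl : irreflexive sub_rel.
Proof.
move=> u; apply/negP => /sub_adj_incl [_ _].
by rewrite adj_irrefl.
Qed.

Definition graph_of_subgraph : sgraph := SGraph sub_rel_sym sub_rel_irrefl.
End SubgraphAsGraph.

Coercion graph_of_subgraph : subgraph >-> sgraph.

(* The simple graph obtained by contracting every S i to one vertex: inl i is
   the vertex replacing S i, inr x is a vertex of G lying in no S i. It is only
   meaningful when the S i are nonempty and pairwise vertex-disjoint. *)
Section Contraction.
Variables (G : sgraph) (I : finType) (S : I -> subgraph G).

Definition contract_vertex : finType :=
  (I + {x : G | x \notin \bigcup_i sub_vertices (S i)})%type.

Definition contract_fiber (a : contract_vertex) : {set G} :=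
  match a with
  | inl i => sub_vertices (S i)
  | inr u => [set val u]
  end.

Definition contract_adj (a b : contract_vertex) : bool :=
  (a != b) &&
  [exists x in contract_fiber a, exists y in contract_fiber b, adj x y].

Lemma contract_adj_sym : symmetric contract_adj.
Proof.
move=> a b; rewrite /contract_adj eq_sym; congr (_ && _).
by apply/exists_inP/exists_inP => -[x xa /exists_inP[y yb xy]];
  exists y => //; apply/exists_inP; exists x; rewrite // adj_sym.
Qed.

Lemma contract_adj_irrefl : irreflexive contract_adj.
Proof. by move=> a; rewrite /contract_adj eqxx. Qed.

Definition contract : sgraph := SGraph contract_adj_sym contract_adj_irrefl.
End Contraction.

(* H is, up to isomorphism, obtained from G by removing vertices and edges. *)
Definition embeds (H G : sgraph) : Prop :=
  exists f : H -> G, injective f /\ forall x y : H, adj x y -> adj (f x) (f y).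

Definition shallow_minor (R : numDomainType) (r : R) (H G : sgraph) : Prop :=
  exists (I : finType) (S : I -> subgraph G),
    [/\ forall i j, i != j ->
          [disjoint sub_vertices (S i) & sub_vertices (S j)],
        forall i, connected_graph (S i) /\ ((radius (S i))%:R <= r)%R
      & embeds H (contract S)].

(* Main.v *)
(* Write [d = expR (k `^ delta)], so that [ln #|G|] is at most linear in [k] and
   hence negligible against every positive power of [d]. A smallest vertex set
   [U] among those spanning at least [c #|U| log #|U|] edges, with [c] about
   [d / log #|G|], has minimum degree at least [c / 2], and each of its subsets
   [S] of size at most [#|U| / 2] has at least [#|S| / O(log #|G|)] outer
   neighbours: otherwise [S] with its neighbours, or the complement of [S],
   would be a smaller such set. Deleting a set [W] that is small compared to
   [c / log #|G|] does not destroy this expansion, so that the balls around any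
   two vertices of [U] grow past half of [U] within [O(log^2 #|G|)] steps and
   meet. One can therefore join [t] chosen centres pairwise and greedily by
   short paths avoiding everything used so far, as all paths together contain only
   [O(t^2 log^2 #|G|)] vertices, which is about [d `^ (1 / 3)]. Assigning each
   path to its first centre yields the branch sets of [K_t]. *)
Require Import Defs.
From HB Require Import structures.
From mathcomp Require Import all_boot all_order all_algebra.
From mathcomp Require Import zify ring lra.

Set Implicit Arguments.
Unset Strict Implicit.
Unset Printing Implicit Defensive.

Import Order.TTheory GRing.Theory Num.Theory.

(** * Edge counts and outer neighbourhoods *)

Section Expansion.
Variable G : sgraph.
Implicit Types (U V W S A : {set G}) (u v x y z : G).

Definition edge_pairs U : {set G * G} :=
  [set p | [&& p.1 \in U, p.2 \in U & adj p.1 p.2]].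

Definition nbhd U S : {set G} :=
  [set y in U :\: S | [exists x in S, adj x y]].

Lemma leq_edges_pairs : #|edges G| <= #|edge_pairs [set: G]|.
Proof.
have -> : edges G = [set [set p.1; p.2] | p in edge_pairs [set: G]].
  apply/setP => e; rewrite inE; apply/existsP/imsetP.
    case=> x /existsP[y /andP[xy /eqP ->]].
    by exists (x, y); rewrite // !inE.
  case=> -[x y]; rewrite !inE /= => xy ->; exists x; apply/existsP; exists y.
  by rewrite xy eqxx.
exact: leq_imset_card.
Qed.

Lemma edge_pairs_eq0 U : #|U| = 0 -> #|edge_pairs U| = 0.
Proof.
move/cards0_eq => ->; apply/eqP; rewrite cards_eq0; apply/eqP/setP => p.
by rewrite !inE.
Qed.

Lemma nbhd_sub U S : nbhd U S \subset U.
Proof. by apply/subsetP => y; rewrite !inE => /andP[/andP[]]. Qed.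

Lemma nbhd_disjoint U S : S :&: nbhd U S = set0.
Proof.
by apply/setP => y; rewrite !inE; case: (y \in S).
Qed.

Lemma card_setU_nbhd U S : #|S :|: nbhd U S| = #|S| + #|nbhd U S|.
Proof. by rewrite cardsU nbhd_disjoint cards0 subn0. Qed.

Lemma leq_card_nbhdD U W S : #|nbhd U S| <= #|nbhd (U :\: W) S| + #|W|.
Proof.
apply: leq_trans (leq_card_setU _ _); apply: subset_leq_card.
apply/subsetP => y; rewrite !inE => /andP[/andP[-> ->] ->].
by case: (y \in W).
Qed.

(** An edge of [U] that meets [S] lies within [S] and its outer neighbours; every other edge avoids
    [S]. *)
Lemma edge_pairs_cover U S :
  #|edge_pairs U| <= #|edge_pairs (S :|: nbhd U S)| + #|edge_pairs (U :\: S)|.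
Proof.
apply: leq_trans (leq_card_setU _ _); apply: subset_leq_card.
apply/subsetP => -[x y]; rewrite !inE /= => /and3P[xU yU xy].
rewrite xU yU xy /= !andbT.
case xS: (x \in S); case yS: (y \in S); rewrite ?orbT //=.
  by rewrite orbF; apply/exists_inP; exists x.
by rewrite orbF andbT; apply/exists_inP; exists y; rewrite // adj_sym.
Qed.

Lemma edge_pairs_del U v : v \in U ->
  #|edge_pairs U| <= #|edge_pairs (U :\ v)| + 2 * #|nbhd U [set v]|.
Proof.
move=> vU; set N := nbhd U [set v].
have -> : 2 * #|N| = #|setX [set v] N| + #|setX N [set v]|.
  by rewrite !cardsX cards1; lia.
apply: (@leq_trans #|edge_pairs (U :\ v) :|: (setX [set v] N :|: setX N [set v])|).
  apply: subset_leq_card; apply/subsetP => -[x y].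
  rewrite !inE /= => /and3P[xU yU xy]; rewrite xU yU xy /= !andbT.
  case: (eqVneq x v) => [xv|_] /=; case: (eqVneq y v) => [yv|_] //=.
  - by move: xy; rewrite xv yv adj_irrefl.
  - by rewrite ?orbF ?andbT; apply/exists_inP; exists v; rewrite ?inE // -xv.
  - by rewrite ?orbF ?andbT; apply/exists_inP; exists v; rewrite ?inE // -yv adj_sym.
apply: leq_trans (leq_card_setU _ _) _; rewrite leq_add2l.
exact: leq_card_setU.
Qed.

(** * Density with a logarithmic weight; critical sets *)

(* Squaring makes the weight drop already when the size shrinks by 2/3, which
   leaves room between 1/2 and 2/3 in the expansion argument. *)
Definition wt (m : nat) : nat := (trunc_log 2 (m ^ 2)).+1.

Lemma leq_wt m n : m <= n -> wt m <= wt n.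
Proof. by move=> mn; rewrite ltnS; apply: leq_trunc_log; rewrite leq_exp2r. Qed.

Lemma wt_shrink m n : 0 < m -> 3 * m <= 2 * n -> wt m < wt n.
Proof.
move=> m0 mn; rewrite ltnS; apply: trunc_log_max => //.
have mm : 0 < m ^ 2 by rewrite expn_gt0 m0.
have/(_ isT) le := trunc_logP (p := 2) _ mm.
rewrite (expnS 2); apply: leq_trans (leq_mul (leqnn 2) le) _; rewrite -!mulnn; nia.
Qed.

Lemma ltn_exp_wt n : n < 2 ^ wt n.
Proof.
apply: leq_ltn_trans (trunc_log_ltn _ _) => //; rewrite expnS expn1; nia.
Qed.

Definition critical (c : nat) U : Prop :=
  [/\ 0 < #|U|, c * (#|U| * wt #|U|) <= #|edge_pairs U|
    & forall V, 0 < #|V| -> #|V| < #|U| ->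
      #|edge_pairs V| < c * (#|V| * wt #|V|)].

Lemma critical_exists c : 0 < #|G| ->
  c * (#|G| * wt #|G|) <= #|edge_pairs [set: G]| -> exists U, critical c U.
Proof.
move=> G0 dG.
pose P U := (0 < #|U|) && (c * (#|U| * wt #|U|) <= #|edge_pairs U|).
have PT : P [set: G] by rewrite /P cardsT G0.
case: (@arg_minnP _ _ P (fun U : {set G} => #|U|) PT) => U /andP[U0 dU] minU.
exists U; split=> // V V0 ltVU; rewrite ltnNge; apply/negP => dV.
by have := minU V; rewrite /P V0 dV leqNgt ltVU => /(_ isT).
Qed.

(** By minimality [U :\ v] spans at most [c * (#|U| - 1) * wt #|U|] ordered pairs, so deleting [v]
    loses at least [c * wt #|U| >= c] of them, and each neighbour of [v] accounts for two. *)
Lemma critical_degree c U v : critical c U -> v \in U ->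
  c <= 2 * #|nbhd U [set v]|.
Proof.
case=> U0 dU minU vU; have := edge_pairs_del vU.
have cU : #|U| = #|U :\ v|.+1 by rewrite (cardsD1 v U) vU.
have : #|edge_pairs (U :\ v)| <= c * (#|U :\ v| * wt #|U|).
  (* Minimality concerns nonempty sets only, so a singleton [U] is treated apart. *)
  case: (posnP #|U :\ v|) => [/edge_pairs_eq0 -> //|V0].
  have := minU _ V0; rewrite cU ltnS leqnn => /(_ isT) /ltnW lt.
  by apply: leq_trans lt _; rewrite !leq_mul // leq_wt.
have : 0 < wt #|U| by [].
move: dU; rewrite cU; move: (wt _) => w.
rewrite mulSn mulnDr => dU w0; have : c <= c * w by apply: leq_pmulr.
lia.
Qed.

(** Let [w = wt h]. If [s + x] is at most 2/3 of [h], the covering sets [S :|: nbhd U S] and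
    [U :\: S] are both smaller than [U], the first of weight at most [w - 1]; minimality then gives
    [h * w < (s + x) * (w - 1) + (h - s) * w], that is, [s < x * (w - 1)]. Otherwise [s <= h / 2]
    forces [s < 3 * x], and [w + 2 >= 3]. *)
Lemma critical_expand c U S : critical c U -> 0 < #|S| -> S \subset U ->
  2 * #|S| <= #|U| -> #|S| <= (wt #|U|).+2 * #|nbhd U S|.
Proof.
case=> U0 dU minU S0 SU S2.
set s := #|S|; set x := #|nbhd U S|; set h := #|U|.
case: (leqP (3 * (s + x)) (2 * h)) => [small|big]; last first.
  have w0 : 0 < wt h by [].
  have s3x : s <= 3 * x by move: S2 big; rewrite -/s -/h; lia.
  by apply: leq_trans s3x _; rewrite leq_mul2r; apply/orP; right; lia.
have cSN : #|S :|: nbhd U S| = s + x by rewrite card_setU_nbhd.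
have cUS : #|U :\: S| = h - s.
  by rewrite cardsD (setIidPr SU).
have hs : 0 < h - s by move: S0 S2; rewrite -/s -/h; lia.
have w1 := wt_shrink (m := s + x) (n := h) ltac:(lia) small.
have lt1 := minU (S :|: nbhd U S).
have {}lt1 := lt1 ltac:(rewrite cSN; lia) ltac:(rewrite cSN -/h; lia).
have lt2 := minU (U :\: S).
have {}lt2 := lt2 ltac:(rewrite cUS; lia) ltac:(rewrite cUS -/h; lia).
have w2 := leq_wt (leq_subr s h).
have := edge_pairs_cover U S; rewrite cSN in lt1; rewrite cUS in lt2.
move=> cov; have : c * (h * wt h) <
    c * ((s + x) * wt (s + x) + (h - s) * wt (h - s)).
  rewrite mulnDr; apply: leq_ltn_trans dU _; apply: leq_ltn_trans cov _.
  by rewrite -addSn leq_add // ltnW.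
rewrite ltn_mul2l => /andP[_]; move: w1 w2.
have e : h = s + (h - s) by lia.
move: (wt _) (wt _) (wt _) => a b w wb wa.
rewrite {1}e; move: (h - s) => r; nia.
Qed.

(** * Growth of balls avoiding a deleted set *)

(* [reach U W u i] collects the ends of walks from [u] with between 1 and
   [i + 1] edges all of whose vertices but [u] lie in [U :\: W]. *)
Fixpoint reach U W u (i : nat) : {set G} :=
  if i is j.+1 then reach U W u j :|: nbhd (U :\: W) (reach U W u j)
  else nbhd (U :\: W) [set u].

Lemma reach_sub U W u i : reach U W u i \subset U :\: W.
Proof.
by elim: i => [|i IH] /=; rewrite ?subUset ?IH nbhd_sub.
Qed.

Lemma reach_walk U W u i y : y \in reach U W u i ->
  exists q, [/\ path (@adj G) u q, all (mem (U :\: W)) q,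
    last u q = y, 0 < size q & size q <= i.+1].
Proof.
elim: i y => [|i IH] y /=.
  move=> yN; exists [:: y]; have yU := subsetP (nbhd_sub _ _) _ yN.
  split=> //=; rewrite andbT //; move: yN; rewrite inE => /andP[_].
  by case/exists_inP=> x; rewrite inE => /eqP ->.
rewrite in_setU => /orP[/IH[q [? ? ? ? sq]]|yN].
  by exists q; split=> //; apply: leq_trans sq _.
have yU := subsetP (nbhd_sub _ _) _ yN.
move: yN; rewrite inE => /andP[_ /exists_inP[x /IH[q [pq aq lq q0 sq]] xy]].
exists (rcons q y); rewrite rcons_path pq lq xy all_rcons aq last_rcons.
by rewrite size_rcons; split=> //; rewrite andbT.
Qed.

Section Growth.
Variables (c m K : nat) (U W : {set G}) (u : G).
Hypothesis critU : critical c U.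
Hypothesis uU : u \in U.
Hypothesis ltK : wt #|U| + 1 < K.
Hypothesis ltm : #|U| < 2 ^ m.
Hypothesis leWc : 2 * (#|W| + 2 * K * #|W| + 1) <= c.

Let B := reach U W u.

(** At least [c / 2 - #|W|] neighbours of [u] survive. This start makes the later loss [K * #|W|]
    less than half of any ball. *)
Lemma card_reach0 : 2 * K * #|W| < #|B 0|.
Proof.
have := critical_degree critU uU; have := leq_card_nbhdD U W [set u].
rewrite /B /=; lia.
Qed.

Lemma card_reach_mono i j : #|B i| <= #|B (i + j)|.
Proof.
elim: j => [|j IH]; first by rewrite addn0.
by apply: leq_trans IH _; rewrite addnS /= subset_leq_card // subsetUl.
Qed.

(** With [x'] new vertices, expansion gives [#|B i| <= K * (x' + #|W|)], and [K * #|W|] is below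
    half of [#|B i|]; hence [#|B i| <= 2 * K * x']. *)
Lemma card_reachS i : 2 * #|B i| <= #|U| ->
  2 * K * #|B i| + #|B i| <= 2 * K * #|B i.+1|.
Proof.
move=> le2; have b0 := card_reach0.
have bi : #|B 0| <= #|B i| := card_reach_mono 0 i.
have BU : B i \subset U by apply: subset_trans (reach_sub _ _ _ _) (subsetDl _ _).
have := critical_expand critU _ BU le2 => /(_ ltac:(lia)).
have := leq_card_nbhdD U W (B i).
rewrite [B i.+1]/= card_setU_nbhd -/(B i).
move: #|nbhd (_ :\: _) _| #|nbhd U _| => x' x xx sx.
have : #|B i| <= K * (x' + #|W|).
  apply: leq_trans sx _; apply: leq_mul; last exact: xx.
  by move: ltK; lia.
have := leq_trans (ltnW b0) bi.
move: #|B i| #|W| => b w; rewrite !mulnDr -!mulnA; lia.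
Qed.

(** Every step below half of [U] adds at least the fraction [1 / (2 * K)] of the initial ball, so
    [2 * K] steps double it. *)
Lemma card_reach_linear i j :
  #|U| < 2 * #|B (i + j)| \/ 2 * K * #|B i| + j * #|B i| <= 2 * K * #|B (i + j)|.
Proof.
elim: j => [|j [IH|IH]]; first by right; rewrite addn0 mul0n addn0.
  left; apply: leq_trans IH _; rewrite leq_mul2l /= addnS -addn1.
  exact: card_reach_mono.
case: (leqP (2 * #|B (i + j)|) #|U|) => [le2|lt2].
  right; rewrite addnS; have := card_reachS le2.
  have := card_reach_mono i j; lia.
left; apply: leq_trans lt2 _; rewrite leq_mul2l /= addnS -addn1.
exact: card_reach_mono.
Qed.

Lemma card_reach_half : #|U| < 2 * #|B (2 * K * m)|.
Proof.
have K0 : 0 < 2 * K by lia.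
have dbl k : #|U| < 2 * #|B (2 * K * k)| \/ 2 ^ k <= #|B (2 * K * k)|.
  elim: k => [|k IH].
    by right; rewrite muln0; have := card_reach0; lia.
  rewrite mulnS addnC.
  case: IH => [lt|le].
    by left; apply: leq_trans lt _; rewrite leq_mul2l /= card_reach_mono.
  case: (card_reach_linear (2 * K * k) (2 * K)) => [|lin]; first by left.
  right; rewrite expnS; move: lin; rewrite -mulnDr leq_pmul2l //; lia.
(* After [m] doublings the ball would have at least [2 ^ m > #|U|] vertices. *)
case: (dbl m) => // le.
have : #|B (2 * K * m)| <= #|U|.
  by apply: subset_leq_card; apply: subset_trans (reach_sub _ _ _ _) (subsetDl _ _).
by move: ltm le; lia.
Qed.

End Growth.

Lemma critical_link c m K U W u v :
  critical c U -> wt #|U| + 1 < K -> #|U| < 2 ^ m ->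
  2 * (#|W| + 2 * K * #|W| + 1) <= c -> u \in U -> v \in U ->
  exists q, [/\ path (@adj G) u q, all (mem (U :\: W)) q,
    adj (last u q) v & size q <= 2 * (2 * K * m).+1].
Proof.
move=> cU hK hm hW uU vU.
have bu := card_reach_half cU uU hK hm hW.
have bv := card_reach_half cU vU hK hm hW.
set Bu := reach U W u _ in bu; set Bv := reach U W v _ in bv.
have : 0 < #|Bu :&: Bv|.
  have : #|Bu :|: Bv| <= #|U|.
    apply: subset_leq_card; apply: subset_trans (subsetDl U W).
    by rewrite subUset !reach_sub.
  rewrite cardsU; have : #|Bu :&: Bv| <= #|Bu| by rewrite subset_leq_card ?subsetIl.
  lia.
case/card_gt0P => z; rewrite inE => /andP[/reach_walk[q [pq aq lq _ sq]]].
case/reach_walk=> -[|y r] [//= /andP[vy pr] /andP[yW ar] lr _ sr].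
(* The walk from [v] to [z] is reversed without its ends: [z] already ends [q], and [v] may lie in
   [W]. The result stops at the neighbour [y] of [v]. *)
exists (q ++ rev (belast y r)).
have prr : path (@adj G) (last y r) (rev (belast y r)).
  rewrite rev_path (eq_path (e' := @adj G)) // => a b; exact: adj_sym.
rewrite cat_path pq lq -lr prr all_cat aq last_cat lq -lr all_rev.
split=> //.
- apply/allP => a /mem_belast; rewrite inE => /orP[/eqP ->|]; first exact: yW.
  by move/(allP ar).
- have -> : last (last y r) (rev (belast y r)) = y.
    by case: r {pr ar lr sr prr} => //= a r; rewrite rev_cons last_rcons.
  by rewrite adj_sym.
- by rewrite size_cat size_rev size_belast mul2n -addnn leq_add // ltnW.
Qed.

End Expansion.

(** * Induced subgraphs and their radius *)

Section InducedSubgraph.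
Variables (G : sgraph) (A : {set G}).

Definition induced_adj : rel G := fun x y => [&& x \in A, y \in A & adj x y].

Lemma induced_adj_sym : symmetric induced_adj.
Proof. by move=> x y; rewrite /induced_adj adj_sym andbCA. Qed.

Lemma induced_adj_incl x y :
  induced_adj x y -> [/\ x \in A, y \in A & adj x y].
Proof. by case/and3P. Qed.

Definition induced : subgraph G := Subgraph induced_adj_sym induced_adj_incl.

Lemma induced_path (x : induced) q : path (@adj G) (val x) q -> all (mem A) q ->
  exists2 p : seq induced, path (@adj induced) x p & map val p = q.
Proof.
elim: q x => [|y q IH] x /=; first by exists [::].
move=> /andP[xy pq] /andP[yA aq].
have [p pp pq'] := IH (exist _ y yA) pq aq.
exists (exist _ y yA :: p); last by rewrite /= pq'.
rewrite /= pp andbT /sub_rel /= /induced_adj yA xy !andbT.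
by case: x {xy} => x xA.
Qed.

Definition centered (r : nat) (x : G) : Prop :=
  x \in A /\ forall y, y \in A -> exists q,
    [/\ path (@adj G) x q, all (mem A) q, last x q = y & size q <= r].

End InducedSubgraph.

Lemma gdist_le (G : sgraph) (x : G) p :
  path (@adj G) x p -> gdist x (last x p) <= size p.
Proof.
move=> pp; rewrite /gdist; set a := fun _ : nat => _.
(* [gdist] never exceeds its junk value [#|G|], which settles long walks; a shorter walk is a
   witness at index [size p]. *)
case: (ltnP (size p) #|G|) => [lt|ge]; last first.
  by apply: leq_trans (find_size _ _) _; rewrite size_iota.
rewrite leqNgt; apply/negP => /(before_find 0).
rewrite nth_iota // add0n => /negbT/negP; apply.
by rewrite /a; apply/existsP; exists (in_tuple p); rewrite /= pp eqxx.
Qed.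

Lemma radius_le (G : sgraph) (x : G) : radius G <= eccentricity x.
Proof.
rewrite /radius; have := mem_index_enum x.
elim: (index_enum G) => // y s IH; rewrite inE big_cons geq_min.
by case/orP=> [/eqP ->|/IH ->]; rewrite ?leqnn ?orbT.
Qed.

Lemma centered_radius (G : sgraph) (A : {set G}) r x : centered A r x ->
  connected_graph (induced A) /\ radius (induced A) <= r.
Proof.
case=> xA cA; pose x' : induced A := exist _ x xA.
have walk (y : induced A) : exists p,
    [/\ path (@adj (induced A)) x' p, last x' p = y & size p <= r].
  have [q [pq aq lq sq]] := cA _ (valP y).
  have [p pp pq'] := @induced_path _ A x' q pq aq.
  exists p; split=> //; last by rewrite -(size_map val) pq'.
  by apply: val_inj; rewrite -last_map pq'.
split.
  split=> [|y z]; first by apply/card_gt0P; exists x'.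
  have con w : connect (@adj (induced A)) x' w.
    by have [p [pp lp _]] := walk w; apply/connectP; exists p.
  by apply: connect_trans (con z); rewrite (sym_connect_sym (@adj_sym _)).
apply: leq_trans (radius_le x') _; apply/bigmax_leqP => y _.
have [p [pp <- sp]] := walk y; exact: leq_trans (gdist_le pp) sp.
Qed.

(** * Greedy construction of branch sets *)

Lemma complete_minor (R : numDomainType) (G : sgraph) t (r : nat)
    (A : 'I_t -> {set G}) (x : 'I_t -> G) :
  (forall i j, i != j -> [disjoint A i & A j]) ->
  (forall i, centered (A i) r (x i)) ->
  (forall i j, i != j -> exists2 y, y \in A i & exists2 z, z \in A j & adj y z) ->
  forall s : R, (r%:R <= s)%R -> shallow_minor s (complete_graph t) G.
Proof.
move=> dA cA aA s rs; exists 'I_t, (fun i => induced (A i)); split=> //.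
  move=> i; have [con rad] := centered_radius (cA i); split=> //.
  by apply: le_trans rs; rewrite ler_nat.
exists inl; split=> [i j [] //|i j /= ij].
rewrite /contract_adj; apply/andP; split.
  by apply: contraNneq ij => -[->].
have [y yA [z zA yz]] := aA _ _ ij.
by apply/exists_inP; exists y => //; apply/exists_inP; exists z.
Qed.

(** Induction on the pairs still to be joined, deleting the union [W] of all current branch sets.
    Every new path starts at the centre [x i] itself, so radii stay at most [L] however many paths
    are added; [w] bounds [#|W|] throughout. *)
Lemma greedy_branch_sets (G : sgraph) c m K (U : {set G}) t (x : 'I_t -> G) :
  let L := 2 * (2 * K * m).+1 in
  let w := t + t * t * L in
  critical c U -> wt #|U| + 1 < K -> #|U| < 2 ^ m ->
  2 * (w + 2 * K * w + 1) <= c -> injective x -> (forall i, x i \in U) ->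
  forall s : seq ('I_t * 'I_t), size s <= t * t ->
  exists A : 'I_t -> {set G},
    [/\ forall i j, i != j -> [disjoint A i & A j],
        forall i, centered (A i) L (x i),
        forall i j, (i, j) \in s ->
          exists2 y, y \in A i & exists2 z, z \in A j & adj y z
      & #|\bigcup_i A i| <= t + size s * L].
Proof.
move=> L w cU hK hm hw injx xU; elim=> [_|[i j] s IH /= lts].
  exists (fun i => [set x i]); split=> //.
  - by move=> i j; rewrite disjoints1 inE (inj_eq injx).
  - move=> i; split=> [|y]; first by rewrite inE.
    by rewrite inE => /eqP ->; exists [::].
  - have -> : \bigcup_i [set x i] = x @: [set: 'I_t].
      apply/setP => y; apply/bigcupP/imsetP.
        by case=> i _; rewrite inE => /eqP ->; exists i.
      by case=> i _ ->; exists i; rewrite ?inE.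
    by rewrite addn0; apply: leq_trans (leq_imset_card _ _) _; rewrite cardsT card_ord.
have [A [dA cA aA cardA]] := IH (ltnW lts).
set W := \bigcup_i A i in cardA.
have Ww : #|W| <= w.
  apply: leq_trans cardA _; rewrite leq_add2l leq_mul2r; apply/orP; right; exact: ltnW.
have hW : 2 * (#|W| + 2 * K * #|W| + 1) <= c.
  apply: leq_trans hw; rewrite leq_mul2l /= leq_add2r.
  by apply: leq_add => //; rewrite leq_mul2l Ww orbT.
have [q [pq aq lq sq]] := critical_link cU hK hm hW (xU i) (xU j).
have AW k : A k \subset W by apply: bigcup_sup.
have qW y : y \in q -> y \notin W by move/(allP aq); rewrite !inE => /andP[].
have dq k : [disjoint [set y in q] & A k].
  rewrite disjoints_subset; apply/subsetP => y; rewrite !inE => /qW.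
  by apply: contra => /(subsetP (AW k)).
pose A' k := if k == i then A i :|: [set y in q] else A k.
have AA' k : A k \subset A' k.
  by rewrite /A'; case: eqP => [->|_] //; apply: subsetUl.
have qA' : {subset q <= A' i} by move=> y yq; rewrite /A' eqxx !inE yq orbT.
exists A'; split.
- move=> k l kl; rewrite /A'; case: (eqVneq k i) => [ki|ki]; case: (eqVneq l i) => [li|li].
  + by rewrite ki li eqxx in kl.
  + rewrite -setI_eq0 setIUl setU_eq0 !setI_eq0 dq andbT dA //.
    by rewrite eq_sym.
  + by rewrite disjoint_sym -setI_eq0 setIUl setU_eq0 !setI_eq0 dq andbT dA // eq_sym.
  + exact: dA.
- move=> k; have [xk ck] := cA k; split; first exact: (subsetP (AA' k)).
  have old y : y \in A k -> exists p, [/\ path (@adj G) (x k) p, all (mem (A' k)) p,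
      last (x k) p = y & size p <= L].
    move=> /ck[p [pp ap lp sp]]; exists p; split=> //.
    by apply: sub_all ap => z; exact: (subsetP (AA' k)).
  move=> y; rewrite {1}/A'; case: eqP => [ki|_]; last exact: old.
  rewrite in_setU => /orP[|]; first by rewrite -ki; apply: old.
  (* A new vertex [y] is reached from the centre by the prefix of [q] ending in [y]. *)
  rewrite inE ki => yq; case/path.splitP: yq pq sq qA' => p1 p2.
  rewrite cat_path => /andP[pp1 _]; rewrite size_cat => sq qA'.
  exists (rcons p1 y); split=> //; last 1 first.
  + by apply: leq_trans sq; apply: leq_addr.
  + by apply/allP => z zp; apply: qA'; rewrite mem_cat zp.
  + by rewrite last_rcons.
- move=> k l; rewrite inE => /orP[/eqP[-> ->]|/aA[y yA [z zA yz]]]; last first.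
    by exists y; [exact: (subsetP (AA' k))|exists z => //; exact: (subsetP (AA' l))].
  exists (last (x i) q); last first.
    by exists (x j) => //; apply: (subsetP (AA' j)); have [] := cA j.
  have := mem_last (x i) q; rewrite inE => /orP[/eqP ->|]; last exact: qA'.
  by apply: (subsetP (AA' i)); have [] := cA i.
- apply: (@leq_trans #|W :|: [set y in q]|).
    apply: subset_leq_card; apply/bigcupsP => k _; rewrite /A'.
    case: eqP => _; first by rewrite setSU.
    by apply: subset_trans (AW k) (subsetUl _ _).
  apply: leq_trans (leq_card_setU _ _) _.
  have : #|[set y in q]| <= L by rewrite cardsE; apply: leq_trans (card_size q) sq.
  by move: cardA; rewrite mulSn; lia.
Qed.

(** [K] serves both as expansion factor and as number of doublings. Then [L <= 5 * K ^ 2],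
    [w <= 5 * (t ^ 2 * K ^ 2)] and [c <= 30 * t ^ 2 * K ^ 3]; the fourth factor [K] bounds
    [wt #|G|]. *)
Lemma dense_complete_minor (R : numDomainType) (G : sgraph) t K (s : R) :
  0 < t -> 0 < #|G| -> wt #|G| + 1 < K ->
  30 * t ^ 2 * K ^ 4 * #|G| <= #|edges G| ->
  ((5 * K ^ 2)%:R <= s)%R -> shallow_minor s (complete_graph t) G.
Proof.
move=> t0 G0 hK eG hs.
pose L := 2 * (2 * K * K).+1; pose w := t + t * t * L.
pose c := 2 * (w + 2 * K * w + 1).
have K3 : 3 <= K by have : 0 < wt #|G| by []; lia.
have L5 : L <= 5 * K ^ 2 by rewrite -mulnn /L; nia.
have c30 : c <= 30 * t ^ 2 * K ^ 3.
  have w5 : w <= 5 * (t ^ 2 * K ^ 2).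
    have : L.+1 <= 5 * K ^ 2 by rewrite -mulnn /L; nia.
    have : w <= t ^ 2 * L.+1 by rewrite -mulnn /w; nia.
    move=> a b; apply: leq_trans a _; rewrite mulnCA leq_mul2l b orbT //.
  have : 1 <= t ^ 2 * K ^ 2 by rewrite muln_gt0 !expn_gt0; lia.
  rewrite -mulnA (expnS K 2) (mulnCA (t ^ 2)) /c; move: (t ^ 2 * K ^ 2) w5 => a w5 a0.
  have Kw : K * w <= 5 * (K * a) by rewrite mulnCA leq_mul2l w5 orbT.
  have Ka : 3 * a <= K * a by rewrite leq_mul2r K3 orbT.
  rewrite -(mulnA 2 K w); move: (K * a) (K * w) Kw Ka => d v; lia.
have dG : c * (#|G| * wt #|G|) <= #|edge_pairs [set: G]|.
  apply: leq_trans (leq_edges_pairs G); apply: leq_trans eG.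
  apply: (@leq_trans (30 * t ^ 2 * K ^ 3 * (#|G| * K))).
    apply: leq_mul => //; rewrite leq_mul2l; apply/orP; right; lia.
  by rewrite (expnSr K 3) !mulnA [leqRHS]mulnAC.
have [U cU] := critical_exists G0 dG.
have UG : #|U| <= #|G| := max_card _.
have wU : wt #|U| + 1 < K by have := leq_wt UG; lia.
have UK : #|U| < 2 ^ K.
  apply: leq_trans (ltn_exp_wt _) _; rewrite leq_exp2l //; lia.
(* The minimum degree [c / 2] exceeds [w >= t], which leaves room for [t] distinct centres. *)
have tU : t <= #|U|.
  have [/card_gt0P[v vU] _ _] := cU; have := critical_degree cU vU.
  have : #|nbhd U [set v]| <= #|U| by rewrite subset_leq_card ?nbhd_sub.
  rewrite /c /w; lia.
pose x (i : 'I_t) : G := enum_val (widen_ord tU i).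
have injx : injective x by move=> i j /enum_val_inj /(congr1 val) /= /val_inj.
have xU i : x i \in U by apply: enum_valP.
have sz : size (enum {: 'I_t * 'I_t}) <= t * t.
  by rewrite -cardE card_prod card_ord.
have [A [dA cA aA _]] :=
  greedy_branch_sets cU wU UK (leqnn _) injx xU sz.
apply: (complete_minor dA cA) => [i j _|]; first by apply: aA; rewrite mem_enum.
by apply: le_trans hs; rewrite ler_nat.
Qed.

(* Real estimates and the choice of [k0] *)
From mathcomp Require Import all_classical all_reals all_analysis.

Local Open Scope ring_scope.

(** With [e = a / n.+1], [expR (a * q)] is the power [n.+1] of [expR (e * q) >= e * q]; the one
    spare factor [q] outweighs [A / e ^+ n.+1]. *)
Lemma expR_dominates_monomial (R : realType) (A a : R) (n : nat) :
  0 <= A -> 0 < a ->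
  exists2 q0 : R, 0 <= q0 & forall q, q0 <= q -> A * q ^+ n <= expR (a * q).
Proof.
move=> A0 a0; pose e := a / n.+1%:R.
have e0 : 0 < e by rewrite divr_gt0 ?ltr0n.
have e1 : 0 < e ^+ n.+1 by rewrite exprn_gt0.
exists (A / e ^+ n.+1) => [|q hq]; first by rewrite divr_ge0 // ltW.
have q0 : 0 <= q by apply: le_trans hq; rewrite divr_ge0 // ltW.
have -> : a * q = n.+1%:R * (e * q).
  by rewrite /e; field; rewrite addrC natr1 pnatr_eq0.
rewrite expRM_natl; apply: (@le_trans _ _ ((e * q) ^+ n.+1)).
  rewrite exprMn (exprS q) mulrA ler_wpM2r ?exprn_ge0 //.
  by rewrite mulrC -ler_pdivrMr.
rewrite lerXn2r ?nnegrE ?expR_ge0 ?mulr_ge0 // ?ltW //.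
by apply: lt_le_trans (expR_ge1Dx _); rewrite ltrDr.
Qed.

Lemma wt_le (R : realType) (b k : R) (n : nat) : 1 < b -> 0 <= k ->
  (0 < n)%N -> n%:R <= b `^ k -> (wt n)%:R <= 1 + 2 * ln b / ln 2 * k.
Proof.
move=> b1 k0 n0 nb; rewrite /wt -natr1 addrC lerD2l.
have ln2 : 0 < ln (2 : R) by rewrite ln_gt0 // ltr1n.
rewrite mulrAC ler_pdivlMr // [leLHS]mulr_natl -lnXn //.
have le2 : (2 : R) ^+ trunc_log 2 (n ^ 2) <= (b `^ k) ^+ 2.
  apply: (@le_trans _ _ (n%:R ^+ 2)); last by rewrite lerXn2r ?nnegrE ?powR_ge0.
  by rewrite -!natrX ler_nat trunc_logP // expn_gt0 n0.
have b0 : 0 < b by apply: lt_trans b1.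
apply: (@le_trans _ _ (ln ((b `^ k) ^+ 2))).
  by rewrite ler_ln ?posrE ?exprn_gt0 ?powR_gt0.
by rewrite lnXn ?powR_gt0 // ln_powR mulr2n; lra.
Qed.

(** Rounding down costs at most a factor [expR 1]: [expR x < t + 1 <= 2 * t] and [2 <= expR 1]. *)
Lemma floor_expR_bounds (R : realType) (x : R) (t : nat) : 0 <= x ->
  t%:Z = Num.floor (expR x) ->
  [/\ (0 < t)%N, t%:R <= expR x & expR (x - 1) <= t%:R].
Proof.
move=> x0 ht; have /andP[] := floor_itv (expR x); rewrite -ht intrD -pmulrn.
move=> lo hi; have t0 : (0 < t)%N.
  rewrite lt0n; apply/eqP => t0; move: hi; rewrite t0 add0r ltNge.
  by rewrite -expR0 ler_expR x0.
split=> //; rewrite expRD expRN ler_pdivrMr ?expR_gt0 //.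
apply: (le_trans (ltW hi)).
have t1 : (1 : R) <= t%:R by rewrite ler1n.
have := expR_ge1Dx (1 : R); nra.
Qed.

Theorem theorem27 (R : realType) (delta mu b : R)
    (hdelta : 2 / 3 < delta <= 1) (hmu : 0 < mu <= 1) (hb : 1 < b) :
  exists k0 : R, 0 <= k0 /\
    forall k : R, k0 <= k ->
    forall t : nat, t%:Z = Num.floor (expR (1 / 6 * k `^ delta)) ->
    forall G : sgraph,
      (0 < #|G|)%N ->
      #|G|%:R <= b `^ k ->
      expR (k `^ delta) * #|G|%:R <= #|edges G|%:R ->
      shallow_minor (t%:R `^ mu) (complete_graph t) G.
Proof.
case/andP: hdelta => d23 d1; case/andP: hmu => mu0 mu1.
(* The 3 collects 1 from [wt_le] and 2 from [K = (wt #|G|).+2]; [k >= 1] absorbs it into [C * k]. *)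
pose C : R := 3 + 2 * ln b / ln 2.
have C0 : 0 < C.
  by rewrite ltr_wpDr ?divr_ge0 ?mulr_ge0 ?ln_ge0 // ?ler1n // ltW.
(* Given [K <= C * q ^+ 2], this bound yields the edge condition, [t ^ 2] having taken a third of
   the exponent. The next one yields the radius bound, its [expR 1] paying for the floor in [t]. *)
have [q1 q1_ge0 hq1] : exists2 q0 : R, 0 <= q0 & forall q, q0 <= q ->
    30 * C ^+ 4 * q ^+ 8 <= expR (2 / 3 * q).
  by apply: expR_dominates_monomial; rewrite ?mulr_ge0 ?exprn_ge0 ?(ltW C0) //; lra.
have [q2 q2_ge0 hq2] : exists2 q0 : R, 0 <= q0 & forall q, q0 <= q ->
    5 * C ^+ 2 * expR 1 * q ^+ 4 <= expR (mu / 6 * q).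
  apply: expR_dominates_monomial; last by lra.
  by rewrite !mulr_ge0 ?exprn_ge0 ?expR_ge0 ?(ltW C0).
pose Q := 1 + q1 + q2; have Q1 : 1 <= Q by rewrite /Q; lra.
exists (Q ^+ 2); split=> [|k kQ t ht G G0 Gb eG]; first by rewrite exprn_ge0 //; lra.
have k1 : 1 <= k by apply: le_trans kQ; rewrite exprn_ege1.
have k0 : 0 <= k by lra.
(* The bounds on [K] become integer powers of [q], and [q <= y] because [delta] exceeds 1/2 and
   [k >= 1]. *)
pose q := Num.sqrt k.
have q2k : q ^+ 2 = k by rewrite sqr_sqrtr.
have qQ : Q <= q by rewrite -(@ler_pXn2r _ 2) ?nnegrE ?sqrtr_ge0 ?q2k //; lra.
pose y := k `^ delta.
have qy : q <= y.
  by rewrite /q -powR12_sqrt // /y ler_powR //; lra.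
have [t0 tle tge] : [/\ (0 < t)%N, t%:R <= expR (1 / 6 * y)
    & expR (1 / 6 * y - 1) <= t%:R].
  by apply: floor_expR_bounds => //; lra.
have hK : (wt #|G|).+2%:R <= C * q ^+ 2.
  have := wt_le hb k0 G0 Gb; rewrite q2k /C mulrDl -addn2 natrD.
  move: (2 * ln b / ln 2) => c; lra.
set K := (wt #|G|).+2 in hK.
apply: (@dense_complete_minor _ _ _ K) => //; first by rewrite addn1.
  rewrite -(ler_nat R); apply: le_trans eG.
  rewrite 3!natrM !natrX ler_wpM2r //.
  have -> : k `^ delta = 2 / 3 * y + 2%:R * (1 / 6 * y) by rewrite -/y; lra.
  rewrite expRD expRM_natl -mulrA [_ ^+ 2 * _]mulrC mulrA.
  apply: ler_pM; rewrite ?mulr_ge0 ?exprn_ge0 //; last first.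
    by rewrite lerXn2r ?nnegrE ?expR_ge0.
  apply: (@le_trans _ _ (30 * C ^+ 4 * q ^+ 8)).
    rewrite -mulrA ler_wpM2l // (exprM q 2 4) -exprMn.
    by rewrite lerXn2r ?nnegrE ?mulr_ge0 ?exprn_ge0 ?(ltW C0) ?sqrtr_ge0.
  apply: (@le_trans _ _ (expR (2 / 3 * q))); first by apply: hq1; rewrite /Q in qQ; lra.
  by rewrite ler_expR; lra.
(* As [mu <= 1], rounding still costs at most a factor [expR 1] after raising to the power [mu]. *)
apply: (@le_trans _ _ (expR (1 / 6 * y - 1) `^ mu)); last first.
  by rewrite ge0_ler_powR ?nnegrE ?expR_ge0 //; lra.
rewrite -expRM; apply: (@le_trans _ _ (expR (mu / 6 * q - 1))); last first.
  rewrite ler_expR; have := ler_wpM2l (ltW mu0) qy; lra.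
rewrite expRB ler_pdivlMr ?expR_gt0 //.
apply: le_trans (hq2 q _); last by rewrite /Q in qQ; lra.
rewrite natrM natrX [leRHS]mulrAC ler_wpM2r ?expR_ge0 // -mulrA ler_wpM2l //.
rewrite (exprM q 2 2) -exprMn.
by rewrite lerXn2r ?nnegrE ?mulr_ge0 ?exprn_ge0 ?(ltW C0) ?sqrtr_ge0.
Qed.
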